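(* For every economy $\Gamma=(I,O,\succ_I,\{C_o\}_{o\in O})$ and every linear order $\rhd$ of the agents $I$, the allocation produced by the YRMH-IGYT algorithm with order $\rhd$ belongs to the rectified core of $\Gamma$ and to the refined exclusion core of $\Gamma$.
   Context: **Economies.** An economy is a tuple $\Gamma=(I,O,\succ_I,\{C_o\}_{o\in O})$, where $I$ is a finite set of agents, $O$ is a finite set of indivisible objects, each agent $i\in I$ demands at most one object and has a strict preference given by a linear order $\succ_i$ on $O\cup\{o^*\}$ ($o^*\notin O$ is a null object), and each object $o$ is owned by a nonempty set $C_o\subseteq I$ of agents. Write $a\succsim_i b$ if $a=b$ or $a\succ_i b$. A coalition is a nonempty subset of $I$; a sub-coalition of $C$ is a nonempty proper subset of $C$. The endowments of a set of agents $C$ are $\omega(C)=\{o\in O: C_o\subseteq C\}$. **Allocations.** An allocation is a map $\mu:I\to O\cup\{o^*\}$ such that each $o\in O$ is assigned to at most one agent ($|\mu^{-1}(o)|\le 1$); any number of agents may be assigned $o^*$. For a coalition $C$, $\mu(C)=\{\mu(i):i\in C\}$. **Self-enforcing.** A coalition $C$ is self-enforcing in an allocation $\sigma$ if $\sigma(C)\subseteq\omega(C)\cup\{o^*\}$; it is minimal self-enforcing in $\sigma$ if it is self-enforcing in $\sigma$ and no sub-coalition of $C$ is self-enforcing in $\sigma$. Let $C_{\sigma=\mu}=\{i\in C:\sigma(i)=\mu(i)\}$. **Rectified core.** An allocation $\mu$ is rectification blocked by a coalition $C$ via another allocation $\sigma$ if: (1) $\sigma(i)\succsim_i\mu(i)$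 for all $i\in C$, and $\sigma(j)\succ_j\mu(j)$ for some $j\in C$; (2) $\sigma(C)\subseteq\omega(C)\cup\{o^*\}$; (3) for every coalition $C'\subseteq C_{\sigma=\mu}$ that is self-enforcing in $\sigma$ and every $i\in C\setminus C'$: $\sigma(i)\in\omega(C')$ implies $\sigma(i)\notin\mu(I\setminus C)$. The rectified core is the set of allocations that are not rectification blocked. **Refined exclusion core.** For a coalition $C$ and an allocation $\mu$, let $C^0=C$, $C^k=C^{k-1}\cup\{i\in I:\mu(i)\in\omega(C^{k-1})\}$ for $k\ge1$, and $\Omega(C|\omega,\mu)=\omega\big(\bigcup_{k=0}^\infty C^k\big)$. An allocation $\mu$ is refined exclusion blocked by a coalition $C$ via another allocation $\sigma$ if: (1) $\sigma(i)\succsim_i\mu(i)$ for all $i\in C$, and $\sigma(j)\succ_j\mu(j)$ for some $j\in C$; (2) for every $j\in I$, $\mu(j)\succ_j\sigma(j)$ implies $\mu(j)\in\Omega(C|\omega,\mu)$; (3) if $C_{\sigma=\mu}\ne\emptyset$, then at least one of the following holds: (a) $C_{\sigma=\mu}$ is self-enforcing in $\sigma$ and, for every $j\in I$, $\mu(j)\succ_j\sigma(j)$ implies $\mu(j)\notin\Omega(C_{\sigma=\mu}|\omega,\mu)$; (b) $C$ is minimal self-enforcing in $\sigma$. The refined exclusion core is the set of allocations that are not refined exclusion blocked. **YRMH-IGYT algorithm.** Fix a linear order $\rhd$ of agents (fixed throughout). A ''current order'' of remaining agents is initialized as $\rhd$ and is updated by the algorithm. Initially every object points to its $\rhd$-highest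 owner. After step $t$, let $I(t)$ be the set of remaining agents, $O(t)$ the set of remaining objects, $C_o(t)$ the set of remaining owners of $o\in O(t)$, and $S_o(t)$ the set of remaining agents who have obtained shared ownership of $o\in O(t)$; $I(0)=I$, $O(0)=O$, $C_o(0)=C_o$, $S_o(0)=\emptyset$. The null object $o^*$ is always available. Step $t\ge1$ (while agents remain): maintain the arcs between remaining agents and objects from the previous step. If the agent pointed to by an object $o\in O(t-1)$ was removed in the previous step, then: if $C_o(t-1)\neq\emptyset$, $o$ now points to the $\rhd$-highest agent in $C_o(t-1)$; if $C_o(t-1)=\emptyset$ and $S_o(t-1)\ne\emptyset$, $o$ points to the $\rhd$-highest agent in $S_o(t-1)$; if both are empty, $o$ points to no agent. Then let the highest-ranked agent $i$ in the current order point to her favorite object $o$ among the remaining objects (including $o^*$). - If $o$ points to no agent, or $o=o^*$, then $i$ obtains $o$ and they are removed. - If $o$ points to an agent and a cycle forms, every agent in the cycle obtains the object she points to, and the agents and objects in the cycle are removed. Moreover, for every agent $j$ in the cycle and every remaining object $a$ with $j\in C_a(t-1)\cup S_a(t-1)$, and for every object $b$ in the cycle and every remaining agent $j'\in C_b(t-1)\cup S_b(t-1)$: if $j'\notin C_a(t-1)\cup S_a(t-1)$, then $j'$ obtains shared ownership of $a$ in following steps (is added to $S_a$). - If $o$ points to an agent but no cycle forms, the agent pointed to by $o$ is moved to the top of the current order. The algorithm stops when all agents are removed. *)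

(* Defs.v *)
From mathcomp Require Import all_boot.

Set Implicit Arguments.
Unset Strict Implicit.
Unset Printing Implicit Defensive.

Definition strict_linear_order (T : eqType) (r : rel T) : Prop :=
  [/\ irreflexive r, transitive r & forall x y, x != y -> r x y || r y x].

(* [option O] is the set of objects together with the null object [None].
   [pref i x y] means that agent [i] strictly prefers [x] to [y]. *)
Record economy (I O : finType) := Economy {
  pref : I -> rel (option O);
  owners : O -> {set I};
  pref_linear : forall i, strict_linear_order (pref i);
  owners_neq0 : forall o, owners o != set0
}.

Definition weakly_prefers (I O : finType) (E : economy I O) (i : I)
    (x y : option O) : bool :=
  (x == y) || pref E i x y.

Definition endow (I O : finType) (E : economy I O) (C : {set I}) : {set O} :=
  [set o | owners E o \subset C].

Definition is_allocation (I O : finType) (mu : {ffun I -> option O}) : Prop :=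
  forall o : O, #|mu @^-1: [set Some o]| <= 1.

Definition coalition (I : finType) (C : {set I}) : bool := C != set0.

Definition sub_coalition (I : finType) (D C : {set I}) : bool :=
  coalition D && (D \proper C).

Definition self_enforcing (I O : finType) (E : economy I O)
    (sigma : {ffun I -> option O}) (C : {set I}) : bool :=
  sigma @: C \subset Some @: endow E C :|: [set None].

Definition minimal_self_enforcing (I O : finType) (E : economy I O)
    (sigma : {ffun I -> option O}) (C : {set I}) : Prop :=
  self_enforcing E sigma C /\
  forall D : {set I}, sub_coalition D C -> ~~ self_enforcing E sigma D.

Definition agree (I O : finType) (C : {set I})
    (sigma mu : {ffun I -> option O}) : {set I} :=
  [set i in C | sigma i == mu i].

Definition weakly_improves (I O : finType) (E : economy I O) (C : {set I})
    (sigma mu : {ffun I -> option O}) : Prop :=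
  (forall i, i \in C -> weakly_prefers E i (sigma i) (mu i)) /\
  (exists2 j, j \in C & pref E j (sigma j) (mu j)).

Definition rectification_blocked (I O : finType) (E : economy I O)
    (mu : {ffun I -> option O}) (C : {set I})
    (sigma : {ffun I -> option O}) : Prop :=
  [/\ weakly_improves E C sigma mu,
      sigma @: C \subset Some @: endow E C :|: [set None]
    & forall C' : {set I}, coalition C' -> C' \subset agree C sigma mu ->
        self_enforcing E sigma C' ->
        forall i, i \in C :\: C' -> sigma i \in Some @: endow E C' ->
          sigma i \notin mu @: (~: C)].

Definition rectified_core (I O : finType) (E : economy I O)
    (mu : {ffun I -> option O}) : Prop :=
  is_allocation mu /\
  forall (C : {set I}) (sigma : {ffun I -> option O}),
    coalition C -> is_allocation sigma -> sigma != mu ->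
    ~ rectification_blocked E mu C sigma.

Fixpoint chain (I O : finType) (E : economy I O) (mu : {ffun I -> option O})
    (C : {set I}) (k : nat) : {set I} :=
  if k is k'.+1 then
    let D := chain E mu C k' in D :|: [set i | mu i \in Some @: endow E D]
  else C.

(* Membership in Omega(C | omega, mu), the endowment of the infinite union of
   the [chain E mu C k]; the null object never belongs to it. *)
Definition ext_endow (I O : finType) (E : economy I O)
    (mu : {ffun I -> option O}) (C : {set I}) (x : option O) : Prop :=
  if x is Some o then
    forall i, i \in owners E o -> exists k, i \in chain E mu C k
  else False.

Definition refined_exclusion_blocked (I O : finType) (E : economy I O)
    (mu : {ffun I -> option O}) (C : {set I})
    (sigma : {ffun I -> option O}) : Prop :=
  [/\ weakly_improves E C sigma mu,
      forall j, pref E j (mu j) (sigma j) -> ext_endow E mu C (mu j)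
    & agree C sigma mu != set0 ->
        (self_enforcing E sigma (agree C sigma mu) /\
         forall j, pref E j (mu j) (sigma j) ->
           ~ ext_endow E mu (agree C sigma mu) (mu j)) \/
        minimal_self_enforcing E sigma C].

Definition refined_exclusion_core (I O : finType) (E : economy I O)
    (mu : {ffun I -> option O}) : Prop :=
  is_allocation mu /\
  forall (C : {set I}) (sigma : {ffun I -> option O}),
    coalition C -> is_allocation sigma -> sigma != mu ->
    ~ refined_exclusion_blocked E mu C sigma.

(* State of the YRMH-IGYT algorithm between two steps.  [order] lists exactly
   the remaining agents, highest-ranked first.  Arcs incident to a removed
   agent or object may linger in [agent_arc] and [object_arc]; they are
   discarded by [arc].  [assigned] is meaningful only on removed agents, and
   [shared] and [object_arc] only on the remaining objects. *)
Record state (I O : finType) := State {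
  order : seq I;
  objects : {set O};
  shared : {ffun O -> {set I}};
  agent_arc : {ffun I -> option O};
  object_arc : {ffun O -> option I};
  assigned : {ffun I -> option O}
}.

Definition agents (I O : finType) (s : state I O) : {set I} :=
  [set i in order s].

(* [rhd i j] means that [i] is ranked above [j]; [None] iff [A] is empty. *)
Definition highest (I : finType) (rhd : rel I) (A : {set I}) : option I :=
  [pick i in A | [forall j in A, (j != i) ==> rhd i j]].

Definition initial (I O : finType) (E : economy I O) (rhd : rel I) :
    state I O :=
  {| order := sort (fun i j => (i == j) || rhd i j) (enum I);
     objects := [set: O];
     shared := [ffun=> set0];
     agent_arc := [ffun=> None];
     object_arc := [ffun o => highest rhd (owners E o)];
     assigned := [ffun=> None] |}.

Definition remaining_owners (I O : finType) (E : economy I O) (s : state I O)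
    (o : O) : {set I} :=
  owners E o :&: agents s.

Definition any_owners (I O : finType) (E : economy I O) (s : state I O)
    (o : O) : {set I} :=
  remaining_owners E s o :|: shared s o.

Definition repoint (I O : finType) (E : economy I O) (rhd : rel I)
    (s : state I O) : {ffun O -> option I} :=
  [ffun o => if object_arc s o is Some j then
               if j \in agents s then Some j
               else if remaining_owners E s o != set0
                    then highest rhd (remaining_owners E s o)
                    else highest rhd (shared s o)
             else None].

(* The default value is never used: [None] is always available and the
   preference is linear, so a favorite exists. *)
Definition favorite (I O : finType) (E : economy I O) (i : I) (R : {set O}) :
    option O :=
  let avail := Some @: R :|: [set None] in
  odflt None [pick x in avail | [forall y in avail, (y != x) ==> pref E i x y]].

Definition arc (I O : finType) (A : {set I}) (R : {set O})
    (aarc : {ffun I -> option O}) (oarc : {ffun O -> option I}) :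
    rel (I + O) :=
  fun u v => match u, v with
  | inl i, inr o => [&& i \in A, o \in R & aarc i == Some o]
  | inr o, inl i => [&& i \in A, o \in R & oarc o == Some i]
  | _, _ => false
  end.

(* Vertices lying on a common closed path with [u].  Every vertex has at most
   one outgoing arc, so if [u] is on a cycle this is the unique such cycle. *)
Definition on_cycle (V : finType) (e : rel V) (u : V) : pred V :=
  fun v => connect e u v && connect e v u.

Definition step (I O : finType) (E : economy I O) (rhd : rel I)
    (s : state I O) : state I O :=
  if order s is i :: rest then
    let oarc := repoint E rhd s in
    let x := favorite E i (objects s) in
    let take_alone :=
      {| order := rest;
         objects := [set a in objects s | Some a != x];
         shared := [ffun a => shared s a :\ i];
         agent_arc := agent_arc s;
         object_arc := oarc;
         assigned := [ffun j => if j == i then x else assigned s j] |} in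
    if x is Some o then
      let aarc := [ffun j => if j == i then Some o else agent_arc s j] in
      if oarc o is Some k then
        let e := arc (agents s) (objects s) aarc oarc in
        if connect e (inr o) (inl i) then
          let cycI := [set j | on_cycle e (inl i) (inl j)] in
          let cycO := [set b | on_cycle e (inl i) (inr b)] in
          {| order := [seq j <- order s | j \notin cycI];
             objects := objects s :\: cycO;
             shared := [ffun a =>
               (shared s a :|:
                [set j' | [exists j in cycI, exists b in cycO,
                   [&& j \in any_owners E s a, j' \in any_owners E s b
                     & j' \notin any_owners E s a]]]) :\: cycI];
             agent_arc := aarc;
             object_arc := oarc;
             assigned :=
               [ffun j => if j \in cycI then aarc j else assigned s j] |}
        else
          {| order := k :: rem k (order s);
             objects := objects s;
             shared := shared s;
             agent_arc := aarc;
             object_arc := oarc;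
             assigned := assigned s |}
      else take_alone
    else take_alone
  else s.

Definition yrmh_outcome (I O : finType) (E : economy I O) (rhd : rel I)
    (mu : {ffun I -> option O}) : Prop :=
  exists t, order (iter t (step E rhd) (initial E rhd)) = [::] /\
            assigned (iter t (step E rhd) (initial E rhd)) = mu.

(* Main.v *)
From mathcomp Require Import all_boot.
Require Import Defs.

Set Implicit Arguments.
Unset Strict Implicit.
Unset Printing Implicit Defensive.

(* Write t(i) for the step at which agent i is removed; i gets her favorite
   among the objects left then, so whatever she prefers was taken strictly
   earlier.  Call Z closed if it contains the owners of mu(i) for every i in Z.
   Sharing keeps the remaining (shared) owners of an object inside any closed
   set containing its owners, so a cycle meeting Z lies in Z; conversely an
   object that points to nobody has its owners in a closed set of removed
   agents.
   Rectified core, and case (b) of refined exclusion: let j in C be the first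
   agent of C to improve.  Her object o was taken earlier by some k outside C.
   As C contains the owners of what its removed members got, o cannot have been
   taken in a cycle, so its owners lie in a closed set of removed agents of C,
   which is self-enforcing in sigma and excludes j.
   Refined exclusion, case (a) (also if C agrees nowhere): the first agents to
   change are harmed, so they lie in the extension C^oo of C but not in the
   extension G^oo of the agreement set, which is closed.  Among the first
   removed agents of C^oo \ G^oo take i entering C^oo at the lowest level.  Her
   object points to one of its owners, who is removed with i, is not in G^oo
   and has a lower level: a contradiction. *)

(** * Preferences, endowments and allocations *)

Lemma linear_asym (T : eqType) (r : rel T) x y :
  strict_linear_order r -> r x y -> ~~ r y x.
Proof.
case=> irr tr _ xy; apply/negP => yx.
by have := tr _ _ _ xy yx; rewrite irr.
Qed.

Lemma some_in_endow (I O : finType) (E : economy I O) (C : {set I}) x :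
  reflect (exists2 o, x = Some o & owners E o \subset C)
          (x \in Some @: endow E C).
Proof.
apply: (iffP imsetP) => [[o]|[o -> oC]]; first by rewrite inE; exists o.
by exists o; rewrite ?inE.
Qed.

Lemma self_enforcingP (I O : finType) (E : economy I O)
    (sigma : {ffun I -> option O}) (C : {set I}) :
  reflect (forall i o, i \in C -> sigma i = Some o -> owners E o \subset C)
          (self_enforcing E sigma C).
Proof.
apply: (iffP subsetP) => [se i o iC io | se x /imsetP[i iC ->]].
  by have := se _ (imset_f sigma iC); rewrite io !inE orbF (mem_imset _ _ Some_inj) inE.
case io: (sigma i) => [o|]; last by rewrite !inE orbT.
by rewrite !inE (mem_imset _ _ Some_inj) inE (se i).
Qed.

Lemma allocation_inj (I O : finType) (mu : {ffun I -> option O}) i j o :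
  is_allocation mu -> mu i = Some o -> mu j = Some o -> i = j.
Proof.
by move=> /(_ o)/card_le1_eqP le1 io jo; apply: le1; rewrite !inE ?io ?jo.
Qed.

(** * Abstract runs and closed sets of agents *)

Section History.
Context (I O : finType) (E : economy I O) (mu : {ffun I -> option O}).

(* An abstract run: [A n] are the agents remaining after [n] steps, [D n a]
   the remaining owners and shared owners of [a], and [p n a] the agent to
   which [a] points during the next step.  A step that removes nobody is
   allowed. *)
Record history (A : nat -> {set I}) (D : nat -> O -> {set I})
    (p : nat -> O -> option I) : Prop := History {
  hist_alloc : is_allocation mu;
  hist_start : A 0 = setT;
  hist_owners : forall a, D 0 a = owners E a;
  hist_mono : forall n, A n.+1 \subset A n;
  hist_end : exists n, A n = set0;
  hist_shared : forall n a j, (j \in D n.+1 a) = (j \in A n.+1) &&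
    ((j \in D n a) || [exists i in A n :\: A n.+1, exists k in A n :\: A n.+1,
       [exists b, [&& mu k == Some b, i \in D n a & j \in D n b]]]);
  hist_favorite : forall n i x, i \in A n :\: A n.+1 -> pref E i x (mu i) ->
    exists o k, [/\ x = Some o, mu k = Some o & k \notin A n];
  hist_pointer : forall n i b, i \in A n :\: A n.+1 -> mu i = Some b ->
    if p n b is Some k then
      [/\ k \in A n :\: A n.+1, k \in D n b
        & owners E b :&: A n != set0 -> k \in owners E b]
    else D n b = set0;
  hist_cycle : forall n (Z : {set I}) i, i \in A n :\: A n.+1 -> i \in Z ->
    (forall j b k, j \in A n :\: A n.+1 -> j \in Z -> mu j = Some b ->
       p n b = Some k -> k \in Z) ->
    A n :\: A n.+1 \subset Z
}.

Context (A : nat -> {set I}) (D : nat -> O -> {set I})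
        (p : nat -> O -> option I) (H : history A D p).

Lemma remaining_mono m n : m <= n -> A n \subset A m.
Proof.
move=> /subnK <-; elim: (n - m) => [|d IH]; first exact: subxx.
exact: subset_trans (hist_mono H _) IH.
Qed.

Lemma removal_time n i : i \notin A n -> exists2 m, m < n & i \in A m :\: A m.+1.
Proof.
elim: n => [|n IH]; first by rewrite (hist_start H) inE.
have [iA iA'|niA _] := boolP (i \in A n); first by exists n; rewrite // inE iA' iA.
by have [m mn im] := IH niA; exists m; rewrite // ltnS ltnW.
Qed.

Lemma removed_before m n i : m < n -> i \in A m :\: A m.+1 -> i \notin A n.
Proof.
move=> mn; rewrite inE => /andP[niA _]; apply: contra niA.
exact/subsetP/remaining_mono.
Qed.

Lemma removal_exists i : exists m, i \in A m :\: A m.+1.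
Proof.
have [n A0] := hist_end H.
by have [|m _ im] := @removal_time n i; [rewrite A0 inE | exists m].
Qed.

Lemma remaining_owner_any n a : owners E a :&: A n \subset D n a.
Proof.
elim: n => [|n IH]; first by rewrite (hist_owners H) subsetIl.
apply/subsetP=> j /setIP[ja jA]; rewrite (hist_shared H) jA (subsetP IH) //.
by rewrite inE ja (subsetP (hist_mono H n)).
Qed.

(** Only members removed before step [n] are constrained, so that a coalition whose allocation
    agrees with [mu] merely up to some step already qualifies. *)
Definition closed_until n (Z : {set I}) : Prop :=
  forall i o, i \in Z -> i \notin A n -> mu i = Some o -> owners E o \subset Z.

(** Induction on [m]. A new sharer of [a] comes from a cycle containing an owner or sharer of [a],
    hence meeting [Z]. Pointers from objects of members of [Z] stay in [Z] by induction, so the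
    whole cycle lies in [Z], and so do those who share its objects. *)
Lemma any_owners_closed m n Z a : closed_until n Z -> m <= n ->
  owners E a \subset Z -> D m a \subset Z.
Proof.
move=> clZ; elim: m a => [|m IH] a lemn aZ; first by rewrite (hist_owners H).
have inZ b : owners E b \subset Z -> D m b \subset Z by apply: IH; apply: ltnW.
apply/subsetP=> j; rewrite (hist_shared H) => /andP[_ /orP[|]].
  exact/subsetP/inZ.
case/exists_inP=> i iJ /exists_inP[k kJ /existsP[b /and3P[/eqP kb ia jb]]].
have JZ: A m :\: A m.+1 \subset Z.
  apply: (hist_cycle H iJ) => [|i' b' k' i'J i'Z i'b' b'k'].
    exact: (subsetP (inZ a aZ)).
  have := hist_pointer H i'J i'b'; rewrite b'k' => -[_ k'D _].
  apply: (subsetP (inZ b' _)) k'D.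
  by apply: clZ i'b' => //; apply: removed_before i'J.
apply: (subsetP (inZ b _)) jb.
by apply: clZ kb; [exact: (subsetP JZ) | exact: removed_before kJ].
Qed.

Lemma cycle_closed m n Z i : closed_until n Z -> m < n ->
  i \in A m :\: A m.+1 -> i \in Z -> A m :\: A m.+1 \subset Z.
Proof.
move=> clZ mn iJ iZ; apply: (hist_cycle H iJ iZ) => j b k jJ jZ jb bk.
have := hist_pointer H jJ jb; rewrite bk => -[_ kD _].
apply: (subsetP (any_owners_closed clZ (ltnW mn) _)) kD.
by apply: clZ jb => //; apply: removed_before jJ.
Qed.

(** If [o] pointed to some agent, she would be in [Z] and removed together with [i], so
    [cycle_closed] would put [i] in [Z]. Hence [o] points to nobody. *)
Lemma outside_closed m n Z i o : closed_until n Z -> m < n ->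
  i \in A m :\: A m.+1 -> mu i = Some o -> owners E o \subset Z ->
  i \notin Z -> D m o = set0.
Proof.
move=> clZ mn iJ io oZ niZ.
have := hist_pointer H iJ io; case: (p m o) => // k [kJ kD _].
have kZ: k \in Z by apply: (subsetP (any_owners_closed clZ (ltnW mn) oZ)).
by have /subsetP/(_ i iJ) := cycle_closed clZ mn kJ kZ; rewrite (negPf niZ).
Qed.

(** Converse to [any_owners_closed]: sharing reaches every remaining member of some closed set
    around the owners of [a]. When [D n a] is empty, this yields a closed set of removed agents. *)
Lemma closed_owner_sets n : exists X : O -> {set I}, forall a,
  [/\ owners E a \subset X a, X a :&: A n \subset D n a & closed_until n (X a)].
Proof.
elim: n => [|n [X XP]].
  exists (owners E) => a; rewrite (hist_owners H) subxx subsetIl; split=> //.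
  by move=> i o _; rewrite (hist_start H) inE.
pose J := A n :\: A n.+1.
(* This replays the sharing rule without deleting those who leave: if the cycle [J] meets [X a],
   then [X b] is added for each object [b] obtained in [J]. *)
exists (fun a => X a :|: [set j | (X a :&: J != set0) &&
  [exists k in J, exists b, (mu k == Some b) && (j \in X b)]]) => a.
split.
- by case: (XP a) => aX _ _; apply: subset_trans aX (subsetUl _ _).
- apply/subsetP=> j /setIP[jX jA']; have jA := subsetP (hist_mono H n) _ jA'.
  rewrite (hist_shared H) jA' /=; move: jX; rewrite inE => /orP[jX|].
    by case: (XP a) => _ /subsetP/(_ j) -> //; rewrite inE jX.
  rewrite inE => /andP[/set0Pn[i /setIP[iX iJ]]].
  case/exists_inP=> k kJ /existsP[b /andP[kb jb]].
  apply/orP; right; apply/exists_inP; exists i => //; apply/exists_inP.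
  exists k => //; apply/existsP; exists b; rewrite kb /=.
  case: (XP a) => _ /subsetP/(_ i) -> /=; last by case/setDP: iJ => iA _; rewrite inE iX.
  by case: (XP b) => _ /subsetP/(_ j) -> //; rewrite inE jb.
(* A member removed before step [n] is handled by the induction hypothesis. For one removed at step
   [n], [X a] meets [J], so the set [X o] of her own object has been added. *)
- move=> i o; have [iJ|niJ] := boolP (i \in J); last first.
    move=> iX niA'; have niA: i \notin A n.
      by apply: contra niJ => iA; rewrite inE niA' iA.
    move: iX; rewrite !inE => /orP[iX|/andP[ne /exists_inP[k kJ /existsP[b /andP[kb ib]]]]] io.
      case: (XP a) => _ _ /(_ i o iX niA io) oX.
      exact: subset_trans oX (subsetUl _ _).
    case: (XP b) => _ _ /(_ i o ib niA io)/subsetP oX.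
    apply/subsetP=> j /oX jb; rewrite !inE ne; apply/orP; right.
    by apply/exists_inP; exists k => //; apply/existsP; exists b; rewrite kb.
  move=> iX _ io; have ne: X a :&: J != set0.
    move: iX; rewrite !inE => /orP[iX|/andP[]//].
    by apply/set0Pn; exists i; rewrite inE iX.
  case: (XP o) => /subsetP oX _ _.
  apply/subsetP=> j /oX jo; rewrite !inE ne; apply/orP; right.
  by apply/exists_inP; exists i => //; apply/existsP; exists o; rewrite io eqxx.
Qed.

(** * Self-enforcing improvements and the rectified core *)

(** The sub-coalition found here violates condition (3) of rectification blocking and also refutes
    minimality in case (b) of refined exclusion blocking. *)
Lemma improving_self_enforcing (C : {set I}) (sigma : {ffun I -> option O}) :
  is_allocation sigma -> weakly_improves E C sigma mu ->
  self_enforcing E sigma C ->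
  exists C' : {set I}, [/\ coalition C', C' \subset agree C sigma mu,
    self_enforcing E sigma C' & exists2 j, j \in C :\: C' &
      sigma j \in Some @: endow E C' /\ sigma j \in mu @: (~: C)].
Proof.
move=> alloc [wk [j1 j1C j1p]] /self_enforcingP seC.
(* [t] will be the first step that removes a member of [C] treated differently by [sigma]; such a
   member strictly improves. *)
pose P n := [exists j in C, (sigma j != mu j) && (j \in A n :\: A n.+1)].
have exP: exists n, P n.
  have [n j1n] := removal_exists j1; exists n; apply/exists_inP; exists j1 => //.
  rewrite j1n andbT; apply: contraTneq j1p => ->.
  by case: (pref_linear E j1) => -> .
case: (ex_minnP exP) => t /exists_inP[j jC /andP[jne jt]] tmin.
have agr i : i \in C -> i \notin A t -> sigma i = mu i.
  move=> iC niA; have [m mt im] := removal_time niA; apply/eqP.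
  apply: contraLR mt => ne; rewrite -leqNgt tmin //.
  by apply/exists_inP; exists i; rewrite ?ne.
have clC: closed_until t C.
  by move=> i o iC niA io; apply: (seC i); rewrite // agr.
have := wk j jC; rewrite /weakly_prefers (negPf jne) /= => jp.
have [o [k [jo ko nkA]]] := hist_favorite H jt jp.
(* A holder [k] in [C], removed before [t], would get [o] in [sigma] as well, and [o] would be
   assigned twice. *)
have nkC: k \notin C.
  apply/negP=> kC; have kj: k = j.
    by apply: allocation_inj alloc _ jo; rewrite agr.
  by move: jne; rewrite -{2}kj jo ko eqxx.
have [m mt km] := removal_time nkA.
have oC := seC j o jC jo.
have Dmo := outside_closed clC mt km ko oC nkC.
(* Nobody owns or shares [o] any longer at step [m], so all of [X o] has been removed by then. Its
   members in [C] therefore agree with [mu], and [X o :&: C] is the required coalition. *)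
have [X /(_ o)[oX]] := closed_owner_sets m; rewrite Dmo subset0 => /eqP Xm clX.
have XA i : i \in X o -> i \notin A m.
  by move=> iX; apply/negP=> iA; have := in_set0 i; rewrite -Xm inE iX iA.
have XAt i : i \in X o -> i \notin A t.
  by move/XA; apply: contra; apply/subsetP/remaining_mono/ltnW.
have oCX: owners E o \subset X o :&: C by rewrite subsetI oX oC.
exists (X o :&: C); split.
- have /set0Pn[w wo] := owners_neq0 E o.
  by apply/set0Pn; exists w; apply: (subsetP oCX).
- by apply/subsetP=> i /setIP[iX iC]; rewrite inE iC agr ?eqxx ?XAt.
- apply/self_enforcingP=> i b /setIP[iX iC] ib; rewrite subsetI (seC i) //.
  by rewrite andbT (clX i) // ?XA // -agr ?XAt.
- exists j; last first.
    split; first by apply/some_in_endow; exists o.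
    by rewrite jo -ko; apply: imset_f; rewrite inE.
  rewrite in_setD jC andbT; apply: contra jne => /setIP[jX _].
  by rewrite agr // XAt.
Qed.

Lemma history_rectified : rectified_core E mu.
Proof.
split=> [|C sigma _ alloc _ [wk se noblock]]; first exact: hist_alloc H.
have [C' [C'0 C'a C'se [j jC [jE jmu]]]] := improving_self_enforcing alloc wk se.
by have := noblock C' C'0 C'a C'se j jC jE; rewrite jmu.
Qed.

(** * Extensions of coalitions and the refined exclusion core *)

Lemma chain_mono (C : {set I}) k l : k <= l -> chain E mu C k \subset chain E mu C l.
Proof.
move=> /subnK <-; elim: (l - k) => [|d IH]; first exact: subxx.
exact: subset_trans IH (subsetUl _ _).
Qed.

(** The chain increases inside the finite set of agents. The induction is on [d], which bounds how
    much it can still grow, and one stationary step makes it constant. *)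
Lemma chain_limit (C : {set I}) :
  exists K, forall k, chain E mu C k \subset chain E mu C K.
Proof.
suff lim d k : #|I| <= #|chain E mu C k| + d ->
    exists K, forall l, chain E mu C l \subset chain E mu C K.
  exact: (lim #|I| 0 (leq_addl _ _)).
elim: d k => [|d IH] k led.
  have /eqP full : chain E mu C k == setT.
    by rewrite eqEcard subsetT cardsT -[#|chain _ _ _ _|]addn0.
  by exists k => l; rewrite full subsetT.
have [stable|grows] := boolP (chain E mu C k.+1 \subset chain E mu C k).
  exists k => l; have [/chain_mono//|/ltnW/subnK <-] := leqP l k.
  suff -> : chain E mu C (l - k + k) = chain E mu C k by [].
  have fix_k: chain E mu C k.+1 = chain E mu C k.
    by apply/eqP; rewrite eqEsubset stable chain_mono.
  by elim: (l - k) => // e IHe; rewrite addSn [LHS]/= IHe -[LHS]/(chain _ _ _ k.+1).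
apply: (IH k.+1); rewrite (leq_trans led) // addnS -addSn leq_add2r.
by apply: proper_card; rewrite properE chain_mono.
Qed.

Lemma history_refined_exclusion : refined_exclusion_core E mu.
Proof.
split=> [|C sigma _ alloc neq [wk harm agr]]; first exact: hist_alloc H.
pose G := agree C sigma mu.
have [Gse Gharm]: self_enforcing E sigma G /\
    forall j, pref E j (mu j) (sigma j) -> ~ ext_endow E mu G (mu j).
  have [G0|/agr[//|[se mse]]] := eqVneq G set0.
    (* The extension of the empty set stays empty because every object has an owner, so it endows
       nothing. *)
    rewrite G0; split; first by apply/self_enforcingP=> i o; rewrite inE.
    move=> j _; case: (mu j) => //= o.
    have [w wo] := set0Pn _ (owners_neq0 E o).
    move/(_ w wo) => -[k]; suff -> : chain E mu set0 k = set0 by rewrite inE.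
    elim: k => //= k ->; rewrite set0U; apply/setP=> i; rewrite !inE.
    apply/some_in_endow => -[b _]; rewrite subset0.
    exact/negP/owners_neq0.
  have [C' [C'0 C'a C'se [j jC _]]] := improving_self_enforcing alloc wk se.
  move: (mse C'); rewrite C'se /sub_coalition C'0 /= => /implyP.
  suff -> : C' \proper C by [].
  have C'C: C' \subset C by apply: subset_trans C'a _; apply/subsetP=> i; rewrite inE => /andP[].
  by apply/properP; split=> //; exists j; case/setDP: jC.
have [KG KGP] := chain_limit G; pose Ginf := chain E mu G KG.
have [KC KCP] := chain_limit C; pose Cinf := chain E mu C KC.
(* At level 0 this is self-enforcement of [G], where [sigma] and [mu] coincide; at later levels it
   is the rule by which the agent entered. *)
have clG k i o : i \in chain E mu G k -> mu i = Some o ->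
    owners E o \subset Ginf.
  elim: k => [|k IH] /=.
    rewrite inE => /andP[iC /eqP sm] io; apply: subset_trans (KGP 0).
    by apply: (self_enforcingP _ _ _ Gse i); rewrite ?sm // inE iC sm /=.
  rewrite in_setU inE => /orP[/IH//|/some_in_endow[b -> bE] [<-]].
  exact: subset_trans bE (KGP k).
pose P n := [exists i, (sigma i != mu i) && (i \in A n :\: A n.+1)].
have exP: exists n, P n.
  have [j _ jp] := wk.2; have [n jn] := removal_exists j.
  exists n; apply/existsP; exists j; rewrite jn andbT.
  by apply: contraTneq jp => ->; case: (pref_linear E j) => -> .
case: (ex_minnP exP) => u /existsP[h0 /andP[h0ne h0u]] umin.
have same i : i \notin A u -> sigma i = mu i.
  move=> niA; have [m mu_ im] := removal_time niA; apply/eqP.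
  apply: contraLR mu_ => ne; rewrite -leqNgt umin //.
  by apply/existsP; exists i; rewrite ne.
(* At the first step [u] with a change, anything better than [mu i] is held by an earlier agent who
   keeps it in [sigma], so the change can only be a loss. *)
have harmed i : i \in A u :\: A u.+1 -> sigma i != mu i -> pref E i (mu i) (sigma i).
  move=> iu ne; case: (pref_linear E i) => _ _ /(_ _ _ ne)/orP[ip|//].
  have [o [k [io ko nkA]]] := hist_favorite H iu ip.
  have ki: k = i by apply: allocation_inj alloc _ io; rewrite same.
  by move: ne; rewrite io -ki ko eqxx.
pose hit t := [exists i, (i \in Cinf :\: Ginf) && (i \in A t :\: A t.+1)].
(* The object lost by [h0] is endowed to [Cinf], which places [h0] one level later in the extension
   of [C]. It is not endowed to [Ginf], so closedness keeps [h0] out of [Ginf]. *)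
have hit_u: hit u.
  apply/existsP; exists h0; rewrite h0u andbT.
  have hp := harmed h0 h0u h0ne; have := harm h0 hp; have := Gharm h0 hp.
  case h0o: (mu h0) => [o|] //= nG inC.
  have oC: owners E o \subset Cinf.
    by apply/subsetP=> w /inC[k]; apply: (subsetP (KCP k)).
  rewrite in_setD; apply/andP; split; last first.
    apply: (subsetP (KCP KC.+1)); rewrite /= in_setU inE h0o; apply/orP; right.
    by apply/some_in_endow; exists o.
  apply/negP=> /clG/(_ h0o)/subsetP oG; apply: nG => w /oG; by exists KG.
case: (ex_minnP (ex_intro _ u hit_u)) => t /existsP[k0 /andP[k0H k0t]] tmin.
have tu := tmin u hit_u.
pose lev l := [exists i, [&& i \in Cinf :\: Ginf, i \in A t :\: A t.+1 & i \in chain E mu C l]].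
have exl: exists l, lev l.
  by exists KC; apply/existsP; exists k0; rewrite k0H k0t; case/setDP: k0H.
case: (ex_minnP exl) => -[|l] /existsP[i /and3P[/setDP[iC niG] it il]] lmin.
  (* Level 0: if [i] in [C] is outside [G], she improves strictly. But she changes and is removed at
     step [t], which forces [t = u], where every change is a loss. *)
  case/negP: niG; apply: (subsetP (KGP 0)); rewrite /= inE.
  rewrite -[C]/(chain E mu C 0) il /=; apply: contraT => ne.
  have := wk.1 i il; rewrite /weakly_prefers (negPf ne) /=.
  rewrite (negPf (linear_asym (pref_linear E i) _)) //.
  apply: harmed => //; suff -> : u = t by [].
  apply/eqP; rewrite eqn_leq tu umin //.
  by apply/existsP; exists i; rewrite ne.
move: il; rewrite /= in_setU inE => /orP[il|/some_in_endow[o io oCl]].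
  suff: l.+1 <= l by rewrite ltnn.
  by apply: lmin; apply/existsP; exists i; rewrite inE niG iC it.
have clGu n : closed_until n Ginf by move=> j b /clG jb _; apply: jb.
have noG: ~~ (owners E o \subset Ginf).
  apply: contra niG => oG; apply: (subsetP (KGP KG.+1)) => /=.
  rewrite in_setU inE io; apply/orP; right; by apply/some_in_endow; exists o.
have [w wo nwG] := subsetPn noG.
have wC: w \in Cinf by apply/(subsetP (KCP l))/(subsetP oCl).
(* An earlier removal of [w] would contradict the minimality of [t]. *)
have wA: w \in A t.
  apply: contraT => /removal_time[m mt wm].
  suff: t <= m by rewrite leqNgt mt.
  by apply: tmin; apply/existsP; exists w; rewrite inE nwG wC.
have wD: w \in D t o by apply: (subsetP (remaining_owner_any t o)); rewrite inE wo.
have := hist_pointer H it io; case: (p t o) => [k [kt _ kown]|D0]; last first.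
  by move: wD; rewrite D0 inE.
(* Priority of remaining original owners over sharers matters here: since [w] remains, [k] is an
   original owner of [o] and thus has level at most [l]. *)
have {}kown: k \in owners E o.
  by apply: kown; apply/set0Pn; exists w; rewrite inE wo.
have kl: k \in chain E mu C l := subsetP oCl k kown.
(* If [k] were in the closed set [Ginf], the cycle would drag [i] into it. Otherwise [k] contradicts
   the minimality of the level of [i]. *)
have [kG|nkG] := boolP (k \in Ginf).
  have := cycle_closed (clGu t.+1) (ltnSn t) kt kG.
  by move/subsetP/(_ i it); rewrite (negPf niG).
suff: l.+1 <= l by rewrite ltnn.
apply: lmin; apply/existsP; exists k; rewrite kt kl !andbT inE nkG /=.
exact: (subsetP (KCP l)).
Qed.

End History.

(** * Greatest elements and favorite objects *)

Lemma pick_greatest (T : finType) (r : rel T) (S : {set T}) :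
  strict_linear_order r ->
  if [pick x in S | [forall y in S, (y != x) ==> r x y]] is Some x
  then x \in S /\ forall y, y \in S -> y != x -> r x y
  else S = set0.
Proof.
case=> irr tr tot; case: pickP => [x /andP[xS /forall_inP xmax]|none].
  by split=> // y yS yx; apply: (implyP (xmax y yS)).
apply/eqP; apply: contraT => /set0Pn[x0 x0S].
(* The greatest element is the one with the fewest elements ranked above it. *)
case: (arg_minnP (fun x => #|[set y | r y x]|) x0S) => x xS xmin.
have {}xS : x \in S := xS; have := none x; rewrite xS /= => /negP[]; apply/forall_inP=> y yS.
apply/implyP=> yx; apply: contraT => nxy.
have yrx: r y x by have := tot _ _ yx; rewrite (negPf nxy) orbF.
have := xmin y yS; rewrite leqNgt proper_card //.
apply/properP; split; last by exists y; rewrite inE ?yrx ?irr.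
by apply/subsetP=> z; rewrite !inE => zy; apply: tr yrx.
Qed.

Section Favorite.
Context (I O : finType) (E : economy I O).

Lemma favorite_spec i (R : {set O}) :
  favorite E i R \in Some @: R :|: [set None] /\
  forall y, y \in Some @: R :|: [set None] -> y != favorite E i R ->
    pref E i (favorite E i R) y.
Proof.
rewrite /favorite.
have := pick_greatest (Some @: R :|: [set None]) (pref_linear E i).
case: [pick _ | _] => //= S0.
by have := in_set0 (None : option O); rewrite -S0 !inE orbT.
Qed.

Lemma favorite_in i (R : {set O}) o : favorite E i R = Some o -> o \in R.
Proof.
by have [+ _ fo] := favorite_spec i R; rewrite fo !inE orbF (mem_imset _ _ Some_inj).
Qed.

Lemma preferred_unavailable i (R : {set O}) x :
  pref E i x (favorite E i R) -> exists2 o, x = Some o & o \notin R.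
Proof.
move=> xf; have [_ best] := favorite_spec i R.
have: x \notin Some @: R :|: [set None].
  apply/negP=> /best; case: eqVneq xf => [->|_ xf /(_ isT) fx].
    by have [irr _ _] := pref_linear E i; rewrite irr.
  by move: xf; rewrite (negPf (linear_asym (pref_linear E i) fx)).
case: x {xf} => [o|]; last by rewrite !inE orbT.
by rewrite !inE orbF (mem_imset _ _ Some_inj) => oR; exists o.
Qed.

(** This is what keeps old agent arcs valid: a favorite that is still available stays the favorite
    after other objects leave. *)
Lemma favorite_shrink i (R R' : {set O}) o :
  R' \subset R -> favorite E i R = Some o -> o \in R' -> favorite E i R' = Some o.
Proof.
move=> sub fo oR'; have [fin best] := favorite_spec i R'.
have [_ bestR] := favorite_spec i R; rewrite fo in bestR.
apply/eqP; apply: contraT => ne.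
have oin: Some o \in Some @: R' :|: [set None].
  by rewrite !inE orbF (mem_imset _ _ Some_inj).
have p1 := best _ oin; rewrite eq_sym ne in p1.
have fR: favorite E i R' \in Some @: R :|: [set None].
  by apply: subsetP fin; apply/setSU/imsetS.
have := bestR _ fR ne.
by rewrite (negPf (linear_asym (pref_linear E i) (p1 isT))).
Qed.

End Favorite.

(** * Cycles in a finite graph, eventually with at most one outgoing arc per vertex *)

Section Cycles.
Context (V : finType) (e : rel V).

Lemma connect_first a b : connect e a b -> a != b -> exists2 v, e a v & connect e v b.
Proof.
case/connectP=> -[|v p] /= => [_ -> /eqP//|/andP[av vp] -> _].
by exists v => //; apply/connectP; exists p.
Qed.

Lemma connect_last a b : connect e a b -> a != b -> exists2 u, connect e a u & e u b.
Proof.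
case/connectP=> p; case/lastP: p => [|p u] /= => [_ -> /eqP//|].
rewrite rcons_path last_rcons => /andP[ap pu] -> _.
by exists (last a p) => //; apply/connectP; exists p.
Qed.

Context (x y : V) (exy : e x y) (cyx : connect e y x).

Lemma on_cycle_start : on_cycle e x x.
Proof. by rewrite /on_cycle connect0. Qed.

Lemma on_cycle_succ u : on_cycle e x u -> exists2 v, e u v & on_cycle e x v.
Proof.
case/andP=> xu ux; have [->|ne] := eqVneq u x.
  by exists y; rewrite // /on_cycle cyx connect1.
have [v uv vx] := connect_first ux ne.
by exists v; rewrite // /on_cycle vx (connect_trans xu) ?connect1.
Qed.

Lemma on_cycle_pred v : on_cycle e x v -> exists2 u, e u v & on_cycle e x u.
Proof.
case/andP=> xv vx; have yv : connect e y v := connect_trans cyx xv.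
have [yv'|ne] := eqVneq y v.
  by exists x; rewrite -?yv' ?on_cycle_start.
have [u yu uv] := connect_last yv ne.
exists u; rewrite // /on_cycle (connect_trans (connect1 exy) yu) /=.
exact: connect_trans (connect1 uv) vx.
Qed.

Lemma on_cycle_connect u v : on_cycle e x u -> on_cycle e x v -> connect e u v.
Proof. by move=> /andP[_ ux] /andP[xv _]; apply: connect_trans xv. Qed.

Context (det : forall u v w, e u v -> e u w -> v = w).

Lemma on_cycle_edge u v : on_cycle e x u -> e u v -> on_cycle e x v.
Proof. by move=> /on_cycle_succ[w uw xw] uv; rewrite (det uv uw). Qed.

(* The successor map sends the finite cycle onto itself, hence is injective. *)
Lemma on_cycle_inj u v w :
  on_cycle e x u -> on_cycle e x v -> e u w -> e v w -> u = v.
Proof.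
pose f a := odflt a [pick b | e a b].
have fE a b : e a b -> f a = b.
  by move=> ab; rewrite /f; case: pickP => [c /(det ab)|/(_ b)]; rewrite ?ab.
pose C := [set a | on_cycle e x a].
have sub: C \subset f @: C.
  apply/subsetP=> b; rewrite inE => /on_cycle_pred[a ab xa].
  by apply/imsetP; exists a; rewrite ?inE ?(fE _ _ ab).
have /imset_injP inj: #|f @: C| == #|C|.
  by rewrite eqn_leq leq_imset_card subset_leq_card.
by move=> xu xv uw vw; apply: inj; rewrite ?inE // (fE _ _ uw) (fE _ _ vw).
Qed.

Lemma on_cycle_closed (P : pred V) u v :
  (forall a b, on_cycle e x a -> P a -> e a b -> P b) ->
  on_cycle e x u -> P u -> on_cycle e x v -> P v.
Proof.
move=> clP xu Pu xv; have /connectP[p up ->] := on_cycle_connect xu xv.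
elim: p u xu Pu up => //= b p IH u xu Pu /andP[ub bp].
by apply: IH bp; [apply: on_cycle_edge ub | apply: clP ub].
Qed.

End Cycles.

(** * Invariants of the algorithm and the effect of one step *)

Section Algorithm.
Context (I O : finType) (E : economy I O) (rhd : rel I).
Context (rhd_linear : strict_linear_order rhd).

Lemma highest_in (S : {set I}) i : highest rhd S = Some i -> i \in S.
Proof.
by have := pick_greatest S rhd_linear; rewrite -/(highest rhd S) => + h; rewrite h => -[].
Qed.

Lemma highest_none (S : {set I}) : highest rhd S = None -> S = set0.
Proof.
by have := pick_greatest S rhd_linear; rewrite -/(highest rhd S) => + h; rewrite h.
Qed.

(** The pointer map is a parameter, so that the condition applies both to the stored arcs and to
    their update by [repoint]. The guard on [k] allows stale arcs to removed agents. *)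
Definition valid_pointers (s : state I O) (f : {ffun O -> option I}) : Prop :=
  forall a, if f a is Some k
    then k \in agents s -> k \in any_owners E s a /\
           (remaining_owners E s a != set0 -> k \in owners E a)
    else any_owners E s a = set0.

Record wf (s : state I O) : Prop := Wf {
  wf_uniq : uniq (order s);
  wf_shared : forall a, shared s a \subset agents s;
  wf_agent_arc : forall i o, i \in agents s -> agent_arc s i = Some o ->
    o \in objects s -> favorite E i (objects s) = Some o;
  wf_object_arc : valid_pointers s (object_arc s);
  wf_alloc : forall i j o, i \notin agents s -> j \notin agents s ->
    assigned s i = Some o -> assigned s j = Some o -> i = j;
  wf_objects : forall o, (o \in objects s) =
    ~~ [exists i, (i \notin agents s) && (assigned s i == Some o)]
}.

Lemma any_owners_sub s a : wf s -> any_owners E s a \subset agents s.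
Proof. by move=> w; rewrite subUset subsetIr wf_shared. Qed.

Lemma repoint_agents s a k : wf s -> repoint E rhd s a = Some k -> k \in agents s.
Proof.
move=> w; rewrite ffunE; case: (object_arc s a) => // j.
case: ifP => [jA [<-] //|_]; case: ifP => [_ /highest_in/setIP[]//|_ /highest_in].
exact/subsetP/wf_shared.
Qed.

Lemma repoint_valid s : wf s -> valid_pointers s (repoint E rhd s).
Proof.
move=> w a; rewrite ffunE; have := wf_object_arc w a.
case: (object_arc s a) => // j jP; case: ifP => [jA /=|_]; first exact: jP.
have [r0 /=|r0 /=] := boolP (remaining_owners E s a == set0).
  case h: (highest _ _) => [k|].
    by move=> _; rewrite /any_owners inE (highest_in h) orbT; split.
  by rewrite /any_owners (eqP r0) (highest_none h) setU0.
case h: (highest _ _) => [k|]; last by rewrite (highest_none h) eqxx in r0.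
by have := highest_in h; rewrite /any_owners in_setU => kr; rewrite kr; case/setIP: kr.
Qed.

(** After a step that removes nobody, object arcs stay put; this lets the graphs of two consecutive
    steps be compared in the termination argument. *)
Lemma repoint_idem s s' : wf s -> agents s' = agents s ->
  object_arc s' = repoint E rhd s -> repoint E rhd s' = repoint E rhd s.
Proof.
move=> w ag oa; apply/ffunP=> a; rewrite [LHS]ffunE oa.
case r: (repoint E rhd s a) => [k|//].
by rewrite ag (repoint_agents w r).
Qed.

(** A uniform summary of all branches of [step]: [J] is a cycle, a single agent taking the null
    object or an object that points to nobody, or empty. Objects and sharing are expressed through
    favorites instead of arcs. *)
Record removal (s s' : state I O) (J : {set I}) : Prop := Removal {
  rm_sub : J \subset agents s;
  rm_agents : agents s' = agents s :\: J;
  rm_uniq : uniq (order s');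
  rm_objects : objects s' =
    [set b in objects s | [forall j in J, favorite E j (objects s) != Some b]];
  rm_shared : forall a, shared s' a = (shared s a :|:
    [set j' | [exists j in J, exists k in J, [exists b,
       [&& favorite E k (objects s) == Some b, j \in any_owners E s a,
           j' \in any_owners E s b & j' \notin any_owners E s a]]]]) :\: J;
  rm_assigned : forall j, assigned s' j =
    if j \in J then favorite E j (objects s) else assigned s j;
  rm_agent_arc : forall j o, j \in agents s' -> agent_arc s' j = Some o ->
    agent_arc s j = Some o \/ favorite E j (objects s) = Some o;
  rm_object_arc : object_arc s' = object_arc s \/ object_arc s' = repoint E rhd s;
  rm_inj : forall j k b, j \in J -> k \in J ->
    favorite E j (objects s) = Some b -> favorite E k (objects s) = Some b -> j = k;
  rm_pointer : forall j b k, j \in J -> favorite E j (objects s) = Some b ->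
    repoint E rhd s b = Some k -> k \in J;
  rm_cycle : forall (Z : {set I}) i, i \in J -> i \in Z ->
    (forall j b k, j \in J -> j \in Z -> favorite E j (objects s) = Some b ->
       repoint E rhd s b = Some k -> k \in Z) -> J \subset Z
}.

Lemma removal_none s s' : wf s -> uniq (order s') -> agents s' = agents s ->
  objects s' = objects s -> shared s' = shared s -> assigned s' = assigned s ->
  (forall j o, j \in agents s' -> agent_arc s' j = Some o ->
    agent_arc s j = Some o \/ favorite E j (objects s) = Some o) ->
  object_arc s' = object_arc s \/ object_arc s' = repoint E rhd s ->
  removal s s' set0.
Proof.
move=> w u ag ob sh asg aa oa; split=> //.
- by rewrite sub0set.
- by rewrite setD0.
- rewrite ob; apply/setP=> b; rewrite !inE; case: (b \in _) => //=; symmetry.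
  by apply/forall_inP=> j; rewrite inE.
- move=> a; rewrite sh setD0; apply/setP=> j; rewrite in_setU inE.
  case: exists_inP => [[k]|]; by rewrite ?inE ?orbF.
- by move=> j; rewrite inE asg.
- by move=> j k b; rewrite inE.
- by move=> j k b; rewrite inE.
- by move=> Z i; rewrite inE.
Qed.

(** An object that points to nobody has no owner or sharer left, so the sharing rule applied to the
    one-agent set [[set i]] adds nothing. *)
Lemma removal_alone s i rest : wf s -> order s = i :: rest ->
  (forall b, favorite E i (objects s) = Some b -> repoint E rhd s b = None) ->
  removal s {| order := rest;
     objects := [set a in objects s | Some a != favorite E i (objects s)];
     shared := [ffun a => shared s a :\ i];
     agent_arc := agent_arc s;
     object_arc := repoint E rhd s;
     assigned := [ffun j => if j == i then favorite E i (objects s)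
                            else assigned s j] |} [set i].
Proof.
move=> w os free; have := wf_uniq w; rewrite os /= => /andP[nir ur].
split=> //=.
- by rewrite sub1set inE os mem_head.
- apply/setP=> j; rewrite !inE os inE /=; case: eqP => // ->.
  by rewrite (negPf nir).
- apply/setP=> b; rewrite !inE; case: (b \in _) => //=; apply/idP/forall_inP.
    by move=> ne j; rewrite inE => /eqP ->; rewrite eq_sym.
  by move/(_ i); rewrite inE eqxx eq_sym => ->.
- move=> a; rewrite ffunE; congr (_ :\: _); apply/setP=> j; rewrite in_setU inE.
  case: exists_inP => [[k _ /exists_inP[l]]|]; rewrite ?orbF // inE => /eqP ->.
  case/existsP=> b /and4P[/eqP/free rb _ + _].
  by have := repoint_valid w b; rewrite rb => ->; rewrite inE.
- by move=> j; rewrite ffunE inE; case: eqP => // ->.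
- by left.
- by right.
- by move=> j k b; rewrite !inE => /eqP -> /eqP ->.
- by move=> j b k; rewrite inE => /eqP -> /free ->.
- by move=> Z j; rewrite inE => /eqP ->; rewrite sub1set.
Qed.

Lemma arc_det (A : {set I}) (R : {set O}) aarc oarc u v w :
  arc A R aarc oarc u v -> arc A R aarc oarc u w -> v = w.
Proof.
case: u v w => [i|o] [j|b] // [k|c] //= /and3P[_ _ /eqP ->] /and3P[_ _ /eqP].
  by case=> ->.
by case=> ->.
Qed.

(** By the invariant, even lingering arcs on the cycle lead to favorites, so the objects of the
    cycle are exactly the favorites of its agents. Injectivity and closure then come from
    determinism of the arcs. *)
Lemma removal_cycle s i rest o : wf s -> order s = i :: rest ->
  favorite E i (objects s) = Some o ->
  let aarc := [ffun j => if j == i then Some o else agent_arc s j] in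
  let e := arc (agents s) (objects s) aarc (repoint E rhd s) in
  connect e (inr o) (inl i) ->
  let cycI := [set j | on_cycle e (inl i) (inl j)] in
  let cycO := [set b | on_cycle e (inl i) (inr b)] in
  removal s {| order := [seq j <- order s | j \notin cycI];
     objects := objects s :\: cycO;
     shared := [ffun a =>
       (shared s a :|:
        [set j' | [exists j in cycI, exists b in cycO,
           [&& j \in any_owners E s a, j' \in any_owners E s b
             & j' \notin any_owners E s a]]]) :\: cycI];
     agent_arc := aarc;
     object_arc := repoint E rhd s;
     assigned := [ffun j => if j \in cycI then aarc j else assigned s j] |} cycI.
Proof.
move=> w os fo aarc e coi cycI cycO.
have iA: i \in agents s by rewrite inE os mem_head.
have oR := favorite_in fo.
have eio: e (inl i) (inr o) by rewrite /e /= iA oR ffunE eqxx /=.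
have det: forall u v z, e u v -> e u z -> v = z by move=> u v z; apply: arc_det.
have succI j : j \in cycI -> exists b, [/\ j \in agents s, b \in objects s,
    aarc j = Some b, favorite E j (objects s) = Some b & b \in cycO].
  rewrite inE => /(on_cycle_succ eio coi)[[//|b] jb cb].
  move: (jb) => /and3P[jA bR /eqP ab]; exists b; split=> //; last by rewrite inE.
  move: ab; rewrite ffunE; case: eqP => [->|_ ab]; first by rewrite -fo.
  exact: wf_agent_arc w _ _ jA ab bR.
have predO b : b \in cycO ->
    exists2 j, j \in cycI & favorite E j (objects s) = Some b.
  rewrite inE => /(on_cycle_pred eio coi)[[j|//] jb cj].
  have jI: j \in cycI by rewrite inE.
  exists j => //; have [b' [_ _ ab' fb' _]] := succI j jI.
  by move: jb => /and3P[_ _ /eqP]; rewrite ab' fb'.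
have edge j b : j \in cycI -> favorite E j (objects s) = Some b -> e (inl j) (inr b).
  move=> /succI[b' [jA bR ab' -> _]] [<-].
  by rewrite /e /= jA bR ab' eqxx.
have favO j b : j \in cycI -> favorite E j (objects s) = Some b -> b \in cycO.
  by move=> /succI[b' [_ _ _ -> bO]] [<-].
have edgeO b k : b \in cycO -> repoint E rhd s b = Some k -> e (inr b) (inl k).
  move=> /predO[j jI fb] bk; rewrite /e /= (repoint_agents w bk) bk eqxx andbT /=.
  exact: favorite_in fb.
split=> //=.
- by apply/subsetP=> j /succI[b []].
- by apply/setP=> j; rewrite !inE mem_filter inE.
- exact/filter_uniq/wf_uniq.
- apply/setP=> b; rewrite in_setD in_set andbC; case: (b \in objects s) => //=.
  apply/idP/forall_inP => [nb j jI|nf].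
    by apply: contra nb => /eqP; apply: favO.
  by apply/negP=> /predO[j /nf]/[swap] ->; rewrite eqxx.
- move=> a; rewrite ffunE; congr ((_ :|: _) :\: _); apply/setP=> j; rewrite !inE.
  apply: eq_existsb => k; congr (_ && _).
  apply/exists_inP/exists_inP.
    case=> b bO /and3P[ka jb nj]; have [l lI lb] := predO b bO.
    by exists l => //; apply/existsP; exists b; rewrite lb eqxx ka jb.
  case=> l lI /existsP[b /and4P[/eqP lb ka jb nj]].
  by exists b; rewrite ?ka ?jb ?nj // (favO _ _ lI lb).
- move=> j; rewrite ffunE; case: ifP => // jI.
  by have [b [_ _ -> -> _]] := succI j jI.
- move=> j b _; rewrite ffunE; case: eqP => [-> [<-]|_ ->]; [by right | by left].
- by right.
- move=> j k b jI kI jb kb; have := edge k b kI kb; have := edge j b jI jb.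
  move=> ejb ekb; move: jI kI; rewrite !inE => jI kI.
  by case: (on_cycle_inj eio coi det jI kI ejb ekb).
- move=> j b k jI jb bk; rewrite inE; have bO := favO _ _ jI jb.
  apply: (on_cycle_edge eio coi det _ (edgeO _ _ bO bk)).
  by move: bO; rewrite inE.
- move=> Z j0 j0I j0Z clZ; apply/subsetP=> j jI.
  (* Membership in [Z] is extended to object vertices through the agent they point to, so that it
     propagates along every arc of the cycle. *)
  pose P (v : I + O) := match v with
    | inl k => k \in Z
    | inr b => if repoint E rhd s b is Some k then k \in Z else true end.
  have clP a b : on_cycle e (inl i) a -> P a -> e a b -> P b.
    case: a b => [k|c] [l|b] //=.
      move=> kI kZ /and3P[_ _ /eqP kb].
      have kI' : k \in cycI by rewrite inE.
      have [b' [_ _ kb' fb' _]] := succI k kI'.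
      move: kb; rewrite kb' => -[bb]; rewrite bb in fb'.
      case r: (repoint _ _ _ _) => [m|//]; exact: (clZ k b m kI' kZ fb' r).
    by move=> _ + /and3P[_ _ /eqP cl]; rewrite cl.
  move: j0I jI; rewrite !inE => j0I jI.
  by have := on_cycle_closed eio coi det clP j0I j0Z jI.
Qed.

Lemma step_removal s : wf s -> exists J, removal s (step E rhd s) J.
Proof.
move=> w; rewrite /step; case os: (order s) => [|i rest].
  exists set0; apply: removal_none; rewrite ?wf_uniq //; by left.
case fo: (favorite E i (objects s)) => [o|]; last first.
  by exists [set i]; rewrite -{1 2}fo; apply: removal_alone; rewrite ?fo.
case ro: (repoint E rhd s o) => [k|]; last first.
  exists [set i]; rewrite -{1 2}fo; apply: removal_alone => //.
  by move=> b; rewrite fo => -[<-].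
have kA := repoint_agents w ro; rewrite inE in kA.
case: ifP => [coi|_].
  by eexists; rewrite -os; apply: removal_cycle os fo coi.
have remE : (if i == k then rest else i :: rem k rest) = rem k (order s).
  by rewrite os.
exists set0; apply: removal_none; rewrite //= ?remE.
- by rewrite mem_rem_uniq ?wf_uniq // inE eqxx /= rem_uniq ?wf_uniq.
- apply/setP=> j; rewrite !inE mem_rem_uniq ?wf_uniq // inE.
  by case: eqP => // ->.
- by move=> j b _; rewrite ffunE; case: eqP => [-> [<-]|_ ->]; [right | left].
- by right.
Qed.

(** With owners and sharers merged, the proviso that a new sharer is not yet an owner or sharer
    becomes redundant. *)
Lemma removal_any_owners s s' J a j : wf s -> removal s s' J ->
  (j \in any_owners E s' a) = (j \in agents s') &&
    ((j \in any_owners E s a) || [exists i in J, exists k in J,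
       [exists b, [&& favorite E k (objects s) == Some b,
          i \in any_owners E s a & j \in any_owners E s b]]]).
Proof.
move=> w R; have JE := rm_agents R.
rewrite {1}/any_owners in_setU (rm_shared R) {1}/remaining_owners in_setI in_setD.
have jA' : (j \in agents s') = (j \notin J) && (j \in agents s).
  by rewrite JE inE.
rewrite jA'; case: (j \in J) => /=; first by rewrite andbF.
rewrite in_setU [in RHS]/any_owners [in RHS]in_setU /remaining_owners in_setI.
have [jA|njA] := boolP (j \in agents s); last first.
  rewrite andbF /=; apply/negP=> /orP[/(subsetP (wf_shared w a))|].
    by rewrite (negPf njA).
  rewrite inE => /exists_inP[i _ /exists_inP[k _ /existsP[b /and4P[_ _ jb _]]]].
  by have := subsetP (any_owners_sub b w) j jb; rewrite (negPf njA).
rewrite andbT /= -orbA; case: (boolP (j \in owners E a)) => //= nja.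
case: (boolP (j \in shared s a)) => //= njs; rewrite inE.
have nj : j \notin any_owners E s a by rewrite !inE negb_or negb_and nja njs.
apply: eq_existsb => i; congr (_ && _); apply: eq_existsb => k; congr (_ && _).
by apply: eq_existsb => b; rewrite nj andbT.
Qed.

Lemma removal_wf s s' J : wf s -> removal s s' J -> wf s'.
Proof.
move=> w R.
have A'A : agents s' \subset agents s by rewrite (rm_agents R) subsetDl.
have R'R : objects s' \subset objects s.
  by rewrite (rm_objects R); apply/subsetP=> b; rewrite inE => /andP[].
have gone j : (j \notin agents s') = (j \in J) || (j \notin agents s).
  by rewrite (rm_agents R) inE negb_and negbK.
have asg_old j o : j \notin J -> j \notin agents s' -> assigned s' j = Some o ->
    j \notin agents s /\ assigned s j = Some o.
  by move=> nJ; rewrite gone (rm_assigned R) (negPf nJ).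
have old_gone j o : j \notin agents s -> assigned s j = Some o -> o \notin objects s.
  move=> jA jo; rewrite wf_objects // negbK; apply/existsP.
  by exists j; rewrite jA jo /=.
split.
- exact: rm_uniq R.
- move=> a; apply/subsetP=> j; rewrite (rm_shared R) (rm_agents R) !in_setD.
  case/andP=> -> /=; rewrite in_setU => /orP[|]; first exact/subsetP/wf_shared.
  rewrite inE => /exists_inP[i _ /exists_inP[k _ /existsP[b /and4P[_ _ + _]]]].
  exact/subsetP/any_owners_sub.
- move=> i o iA' arc_o oR'; have oR := subsetP R'R o oR'.
  apply: favorite_shrink R'R _ oR'.
  have [arc_o'|//] := rm_agent_arc R iA' arc_o.
  exact: wf_agent_arc w _ _ (subsetP A'A i iA') arc_o' oR.
(* Valid pointers survive a removal: remaining owners only shrink, a remaining owner or sharer keeps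
   that status, and an object without any can gain none. *)
- have keep f : valid_pointers s f -> valid_pointers s' f.
    move=> vf a; have := vf a; case: (f a) => [k kP kA'|a0]; last first.
      apply/setP=> j; rewrite (removal_any_owners _ _ w R) a0 !inE /=.
      apply/negP=> /andP[_ /exists_inP[i _ /exists_inP[l _ /existsP[b]]]].
      by rewrite inE andbF.
    have kA := subsetP A'A k kA'; have [ka kown] := kP kA.
    split; first by rewrite (removal_any_owners _ _ w R) kA' ka.
    case/set0Pn=> x /setIP[xa xA']; apply: kown; apply/set0Pn; exists x.
    by rewrite inE xa (subsetP A'A).
  by case: (rm_object_arc R) => ->; apply: keep; [apply: wf_object_arc | apply: repoint_valid].
- move=> i j o niA' njA' io jo.
  (* Two agents of [J] have distinct favorites, and an object assigned earlier is no longer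
     available as a favorite. *)
  have [iJ|niJ] := boolP (i \in J); have [jJ|njJ] := boolP (j \in J).
  + by apply: (rm_inj R iJ jJ (b := o)); [rewrite -io | rewrite -jo]; rewrite (rm_assigned R) ?iJ ?jJ.
  + have [jA jo'] := asg_old j o njJ njA' jo.
    by move: io; rewrite (rm_assigned R) iJ => /favorite_in; rewrite (negPf (old_gone _ _ jA jo')).
  + have [iA io'] := asg_old i o niJ niA' io.
    by move: jo; rewrite (rm_assigned R) jJ => /favorite_in; rewrite (negPf (old_gone _ _ iA io')).
  + have [jA jo'] := asg_old j o njJ njA' jo; have [iA io'] := asg_old i o niJ niA' io.
    exact: wf_alloc w _ _ _ iA jA io' jo'.
- move=> o; rewrite (rm_objects R) inE (wf_objects w).
  apply/andP/negP => [[/existsPn old /forall_inP new] /existsP[i /andP[]]|none].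
    rewrite gone (rm_assigned R); have [iJ _|niJ /= iA] := boolP (i \in J).
      by rewrite (negPf (new i iJ)).
    by have := old i; rewrite iA /= => /negPf ->.
  split.
    apply/existsPn=> i; apply/negP=> /andP[iA io]; apply: none; apply/existsP.
    exists i; rewrite gone iA orbT (rm_assigned R).
    case: ifP => // iJ; by rewrite (subsetP (rm_sub R) i iJ) in iA.
  apply/forall_inP=> j jJ; apply/negP=> jo; apply: none; apply/existsP.
  by exists j; rewrite gone jJ (rm_assigned R) jJ.
Qed.

Lemma initial_wf : wf (initial E rhd).
Proof.
have ag : agents (initial E rhd) = setT.
  by apply/setP=> i; rewrite !inE mem_sort mem_enum.
split=> /=.
- by rewrite sort_uniq enum_uniq.
- by move=> a; rewrite ffunE sub0set.
- by move=> i o _; rewrite ffunE.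
- have anyE a : any_owners E (initial E rhd) a = owners E a.
    by rewrite /any_owners /remaining_owners ag setIT ffunE setU0.
  move=> a; rewrite ffunE; case h: (highest _ _) => [k|].
    by rewrite anyE (highest_in h).
  by rewrite anyE (highest_none h).
- by move=> i j o; rewrite ag inE.
- by move=> o; rewrite inE; symmetry; apply/existsPn=> i; rewrite ag inE.
Qed.

(** * Iterated steps and termination *)

Definition run t := iter t (step E rhd) (initial E rhd).

Lemma run_wf t : wf (run t).
Proof.
elim: t => [|t IH]; first exact: initial_wf.
by have [J R] := step_removal IH; apply: removal_wf R.
Qed.

Lemma run_removal t : removal (run t) (run t.+1) (agents (run t) :\: agents (run t.+1)).
Proof.
have [J R] := step_removal (run_wf t); rewrite -/(run t.+1) in R.
suff -> : agents (run t) :\: agents (run t.+1) = J by [].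
by rewrite (rm_agents R) setDDr setDv set0U; apply/setIidPr/(rm_sub R).
Qed.


Definition reaching (s : state I O) (i : I) : {set I} :=
  [set j | connect (arc (agents s) (objects s) (agent_arc s) (repoint E rhd s))
                   (inl j) (inl i)].

(** A lexicographic measure coded as one number: first the number of remaining agents, then the
    number of agents from whom the top agent cannot be reached. The latter is at most [#|I|], hence
    the weight [#|I|.+1]. *)
Definition progress (s : state I O) : nat :=
  if order s is i :: _ then #|agents s| * #|I|.+1 + (#|I| - #|reaching s i|)
  else 0.

(* A step removing nobody moves the top to an agent [k] that the old top can
   reach but that could not reach the old top, as no cycle formed. *)
Lemma progress_step s : wf s -> order s != [::] ->
  order (step E rhd s) = [::] \/ progress (step E rhd s) < progress s.
Proof.
move=> w; case os: (order s) => [//|i rest] _; set s' := step E rhd s.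
have fewer : #|agents s'| < #|agents s| ->
    order s' = [::] \/ progress s' < progress s.
  rewrite /progress os; case: (order s') => [|k r] lt; [by left|right].
  rewrite (@leq_trans (#|agents s| * #|I|.+1)) ?leq_addr //.
  apply: (@leq_trans (#|agents s'|.+1 * #|I|.+1)); last by rewrite leq_mul2r lt orbT.
  by rewrite mulSn addnC ltn_add2r ltnS leq_subr.
have iA : i \in agents s by rewrite inE os mem_head.
have drop (J : {set I}) : removal s s' J -> i \in J -> #|agents s'| < #|agents s|.
  move=> R iJ; rewrite (rm_agents R); apply: proper_card.
  by apply/properP; split; [exact: subsetDl | exists i; rewrite // inE iJ].
have [J R] := step_removal w.
have [iJ|niJ] := boolP (i \in J); first exact/fewer/(drop J).
have iA' : i \in agents s' by rewrite (rm_agents R) inE niJ.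
move: iA'; rewrite /s' /step os.
case fo: (favorite E i (objects s)) => [o|]; last first.
  by rewrite inE /=; have := wf_uniq w; rewrite os /= => /andP[/negPf ->].
case ro: (repoint E rhd s o) => [k|]; last first.
  by rewrite inE /=; have := wf_uniq w; rewrite os /= => /andP[/negPf ->].
set aarc := finfun _; set e := arc _ _ aarc _.
case: ifP => [coi|nc _].
  by rewrite inE /= in_set on_cycle_start /= mem_filter in_set on_cycle_start.
right.
have remE : (if i == k then rest else i :: rem k rest) = rem k (order s).
  by rewrite os.
rewrite [rem _ _]/= remE; set s1 := State _ _ _ _ _ _.
have ag : agents s1 = agents s.
  apply/setP=> j; rewrite !inE mem_rem_uniq ?wf_uniq // inE.
  have := repoint_agents w ro; rewrite inE.
  by case: eqP => // ->.
have eE : arc (agents s1) (objects s1) (agent_arc s1) (repoint E rhd s1) = e.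
  by rewrite ag (repoint_idem w ag).
rewrite /progress os -/(order s1) /= ag ltn_add2l.
have kA := repoint_agents w ro.
(* The step redraws only the outgoing arc of [i], and a path to [i] may be cut at its first visit
   there, so it survives in [e]. *)
have lift j : j \in reaching s i -> connect e (inl j) (inl i).
  rewrite inE => /connectP[p]; elim: p (inl j : I + O) => [|v p IH] u /=.
    by move=> _ ->.
  case/andP=> uv vp last_i; have [->//|ne] := eqVneq u (inl i).
  apply: connect_trans (IH v vp last_i); apply: connect1.
  move: u v uv ne {vp last_i IH} => [a|b] [c|d] //=.
  by rewrite /e /= ffunE; case: (eqVneq a i) => [->|//]; rewrite eqxx.
have oR := favorite_in fo.
have ik : connect e (inl i) (inl k).
  apply: (@connect_trans _ _ (inr o)); apply: connect1; rewrite /e /=.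
    by rewrite iA oR ffunE eqxx /=.
  by rewrite kA oR ro eqxx.
have lt : #|reaching s i| < #|reaching s1 k|.
  apply: proper_card; apply/properP; split.
    by apply/subsetP=> j /lift ji; rewrite inE eE; apply: connect_trans ik.
  (* [k] reaches itself but not [i]: otherwise the arc from [o] to [k] would close a cycle. *)
  exists k; first by rewrite inE connect0.
  apply/negP=> /lift ki; move/negP: nc; apply.
  apply: connect_trans ki; apply: connect1.
  by rewrite /e /= kA oR ro eqxx.
by apply: ltn_sub2l => //; apply: leq_trans lt (max_card _).
Qed.

Lemma run_terminates : exists t, order (run t) = [::].
Proof.
suff term d t : progress (run t) < d -> exists t', order (run t') = [::].
  exact: (term (progress (run 0)).+1 0 (leqnn _)).
elim: d t => // d IH t led.
have [done_t|more] := eqVneq (order (run t)) [::]; first by exists t.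
have [done_t|lt] := progress_step (run_wf t) more; first by exists t.+1.
by apply: (IH t.+1); apply: leq_trans lt _; rewrite -ltnS.
Qed.

(** * The run as an abstract history, and the conclusion *)

Lemma run_stop t t' : order (run t) = [::] -> t <= t' -> run t' = run t.
Proof.
move=> stop /subnK <-; elim: (t' - t) => // d IH.
by rewrite addSn [LHS]/= -/(run _) IH /step stop.
Qed.

Lemma run_agents_mono t t' : t <= t' -> agents (run t') \subset agents (run t).
Proof.
move=> /subnK <-; elim: (t' - t) => [|d IH]; first exact: subxx.
by rewrite addSn; apply: subset_trans IH; rewrite (rm_agents (run_removal _)) subsetDl.
Qed.

Lemma run_assigned t t' i : t <= t' -> i \notin agents (run t) ->
  assigned (run t') i = assigned (run t) i.
Proof.
move=> + niA; move=> /subnK <-; elim: (t' - t) => // d IH.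
rewrite addSn (rm_assigned (run_removal _)) IH in_setD.
suff /negPf -> : i \notin agents (run (d + t)) by rewrite andbF.
by apply: contra niA; apply/subsetP/run_agents_mono/leq_addl.
Qed.

(** Assignments are final once made, so [mu i] is the favorite of [i] at her removal step. This
    translates the one-step summaries, stated with favorites, into statements about [mu]. *)
Lemma run_history T : order (run T) = [::] ->
  history E (assigned (run T)) (fun n => agents (run n))
    (fun n a => any_owners E (run n) a) (fun n => repoint E rhd (run n)).
Proof.
move=> stop; set mu := assigned (run T).
have AT : agents (run T) = set0 by apply/setP=> i; rewrite !inE stop.
have muE n i : i \notin agents (run n) -> mu i = assigned (run n) i.
  move=> niA; have [le|/ltnW le] := leqP n T; first exact: run_assigned.
  by rewrite (run_stop stop le).
have favE n i : i \in agents (run n) :\: agents (run n.+1) ->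
    mu i = favorite E i (objects (run n)).
  move=> iJ; rewrite (muE n.+1); last by case/setDP: iJ.
  by rewrite (rm_assigned (run_removal n)) iJ.
split.
- move=> o; apply/card_le1_eqP => i j; rewrite !inE => /eqP io /eqP jo.
  by apply: (wf_alloc (run_wf T) _ _ jo io); rewrite AT inE.
- by apply/setP=> i; rewrite !inE mem_sort mem_enum.
- move=> a; rewrite /any_owners /= ffunE setU0 /remaining_owners.
  by apply/setIidPl/subsetP=> i _; rewrite !inE mem_sort mem_enum.
- by move=> n; apply: run_agents_mono.
- by exists T.
- move=> n a j; rewrite (removal_any_owners _ _ (run_wf n) (run_removal n)).
  congr (_ && (_ || _)); apply: eq_existsb => i; congr (_ && _).
  apply: eq_existsb => k; case: (boolP (k \in _)) => //= kJ.
  by apply: eq_existsb => b; rewrite (favE n).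
- move=> n i x iJ; rewrite (favE n) // => /preferred_unavailable[o -> oR].
  move: oR; rewrite (wf_objects (run_wf n)) negbK => /existsP[k /andP[kA /eqP ko]].
  by exists o, k; rewrite (muE n).
- move=> n i b iJ; rewrite (favE n) // => ib.
  have := repoint_valid (run_wf n) b; case bk: (repoint _ _ _ _) => [k|//] kP.
  have kJ := rm_pointer (run_removal n) iJ ib bk.
  by have [kb kown] := kP (repoint_agents (run_wf n) bk).
- move=> n Z i iJ iZ clZ; apply: (rm_cycle (run_removal n) iJ iZ) => j b k jJ jZ jb.
  by apply: (clZ j b k jJ jZ); rewrite (favE n).
Qed.

End Algorithm.

Theorem theorem3 (I O : finType) (E : economy I O) (rhd : rel I)
    (rhd_linear : strict_linear_order rhd) :
  exists mu : {ffun I -> option O},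
    [/\ unique (yrmh_outcome E rhd) mu,
        rectified_core E mu
      & refined_exclusion_core E mu].
Proof.
have [T stop] := run_terminates E rhd_linear.
have H := run_history rhd_linear stop.
exists (assigned (run E rhd T)); split.
(* The steps are deterministic and the state is constant once the order is empty, so any two
   stopping times give the same assignment. *)
- split=> [|_ [t [stop_t <-]]]; first by exists T.
  have [le|/ltnW le] := leqP t T.
    by rewrite (run_stop stop_t le).
  by rewrite -/(run E rhd t) (run_stop stop le).
- exact: history_rectified H.
- exact: history_refined_exclusion H.
Qed.
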